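(* Let $f_1,\dots,f_n:X\to Y$ and $g_1,\dots,g_n:X'\to Y'$ be maps, and suppose that there are homotopy equivalences $\beta:X'\to X$ and $\eta:Y'\to Y$ such that $f_i\circ\beta\simeq\eta\circ g_i$ for all $i\in\{1,2,\dots,n\}$. Then $\mathrm{D}(f_1,f_2,\dots,f_n)=\mathrm{D}(g_1,g_2,\dots,g_n)$.
   Context: All maps are continuous. For maps $f_1,\dots,f_n:X\to Y$, the $n$-th homotopic distance $\mathrm{D}(f_1,\dots,f_n)$ is the least non-negative integer $k$ such that there exist open subsets $U_0,\dots,U_k$ covering $X$ with $f_1|_{U_j}\simeq f_2|_{U_j}\simeq\cdots\simeq f_n|_{U_j}$ (homotopic as maps $U_j\to Y$) for all $j\in\{0,\dots,k\}$; if no such covering exists, $\mathrm{D}(f_1,\dots,f_n)=\infty$. *)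

(* Defs.v *)
From HB Require Import structures.
From mathcomp Require Import all_boot all_order all_algebra.
From mathcomp Require Import all_classical reals constructive_ereal topology normedtype.

Set Implicit Arguments.
Unset Strict Implicit.
Unset Printing Implicit Defensive.

Import Order.TTheory GRing.Theory Num.Theory.
Import numFieldNormedType.Exports.

Local Open Scope classical_set_scope.
Local Open Scope ring_scope.

Section UnitInterval.
Variable R : realType.

Definition unit_interval : Type := set_type (`[0, 1]%classic : set R).
HB.instance Definition _ := Topological.on unit_interval.

Fact unit_interval0_subproof : (0 : R) \in (`[0, 1]%classic : set R).
Proof. by rewrite inE/= in_itv/= lexx ler01. Qed.

Fact unit_interval1_subproof : (1 : R) \in (`[0, 1]%classic : set R).
Proof. by rewrite inE/= in_itv/= lexx ler01. Qed.

Definition unit_interval0 : unit_interval := exist _ 0 unit_interval0_subproof.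
Definition unit_interval1 : unit_interval := exist _ 1 unit_interval1_subproof.

End UnitInterval.

Section Homotopy.
Variable R : realType.

(* Continuity of f and g is not required separately: it follows from that of
   the homotopy. *)
Definition homotopic (X Y : topologicalType) (f g : X -> Y) : Prop :=
  exists H : X * unit_interval R -> Y,
    [/\ continuous H,
        forall x, H (x, unit_interval0 R) = f x &
        forall x, H (x, unit_interval1 R) = g x].

Definition homotopy_equivalence (X Y : topologicalType)
    (f : continuousType X Y) : Prop :=
  exists g : continuousType Y X,
    homotopic (g \o f) idfun /\ homotopic (f \o g) idfun.

Section HomotopicDistance.
Variables (X Y : topologicalType) (n : nat) (f : 'I_n -> continuousType X Y).

(* sigL U h is the restriction of h to the subspace U; the chain f_1 ~ ... ~ f_n
   is read as consecutive homotopies. *)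
Definition has_homotopic_cover (k : nat) : Prop :=
  exists U : 'I_k.+1 -> set X,
    [/\ forall j, open (U j),
        \bigcup_j U j = [set: X] &
        forall (j : 'I_k.+1) (i i' : 'I_n), i' = i.+1 :> nat ->
          homotopic (sigL (U j) (f i)) (sigL (U j) (f i'))].

Definition homotopic_distance : \bar nat :=
  match pselect (exists k, `[< has_homotopic_cover k >]) with
  | left exk => EFin (ex_minn exk)
  | right _ => +oo%E
  end.

End HomotopicDistance.
End Homotopy.

(* Main.v *)
(** Let [b] precompose and [e] postcompose the [f i] to maps homotopic to the
    [g i]. An open cover trivialising the [f i] pulls back along [b] to one
    trivialising the [g i]: over [b^-1 U] one has
    [g i ~ e f_i b ~ e f_i' b ~ g i']. Taking [b = beta] and [e] a homotopy
    inverse of [eta], and then [e = eta] and [b] a homotopy inverse of [beta],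
    shows that [f] and [g] have covers of the same sizes. *)

Require Import Defs.
From HB Require Import structures.
From mathcomp Require Import all_boot all_order all_algebra.
From mathcomp Require Import all_classical reals constructive_ereal topology normedtype.
From mathcomp Require Import lra.

Set Implicit Arguments.
Unset Strict Implicit.
Unset Printing Implicit Defensive.

Import Order.TTheory GRing.Theory Num.Theory.
Import numFieldNormedType.Exports.

Local Open Scope classical_set_scope.
Local Open Scope ring_scope.

Lemma continuous_pair (T U V : topologicalType) (a : T -> U) (b : T -> V) :
  continuous a -> continuous b -> continuous (fun x => (a x, b x)).
Proof. by move=> ca cb x; apply: cvg_pair; [exact: ca|exact: cb]. Qed.

Lemma continuous_set_val (X : topologicalType) (U : set X) :
  continuous (set_val : U -> X).
Proof. exact: initial_continuous. Qed.

Section Reparametrization.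
Variable R : realType.
Notation I := (unit_interval R).

Lemma unit_interval_bounds (t : I) : 0 <= val t <= 1.
Proof. by have := valP t; rewrite inE/= in_itv. Qed.

Lemma continuous_unit_interval_val : continuous (val : I -> R).
Proof. by rewrite -set_valE; exact: continuous_set_val. Qed.

(** Lets a change of time be given by a real formula: time reversal and the two halves of a
    concatenation are obtained this way. *)
Lemma unit_interval_reparam (h : R -> R) :
  continuous h -> (forall t, 0 <= t <= 1 -> 0 <= h t <= 1) ->
  exists2 k : I -> I, continuous k & forall t, val (k t) = h (val t).
Proof.
move=> ch h01.
have hI (t : I) : h (val t) \in (`[0, 1]%classic : set R).
  by rewrite inE/= in_itv/=; exact/h01/unit_interval_bounds.
exists (fun t => exist _ (h (val t)) (hI t)) => //.
apply: continuous_comp_initial => t.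
rewrite set_valE.
apply: (@continuous_comp _ _ _ (val : I -> R) h); last exact: ch.
exact: continuous_unit_interval_val.
Qed.

End Reparametrization.

Section Homotopic.
Variable R : realType.
Notation I := (unit_interval R).

Lemma homotopic_comp (X Y Z W : topologicalType) (a : X -> Y) (f g : Y -> Z)
    (b : Z -> W) :
  continuous a -> continuous b -> homotopic R f g ->
  homotopic R (b \o f \o a) (b \o g \o a).
Proof.
move=> ca cb [H [cH H0 H1]].
exists (fun p => b (H (a p.1, p.2))); split => [p|x|x] /=; last 2 first.
- by rewrite H0.
- by rewrite H1.
apply: (@continuous_comp _ _ _ _ b); last exact: cb.
apply: (@continuous_comp _ _ _ (fun p : X * I => (a p.1, p.2)) H); last exact: cH.
apply: continuous_pair => [q|q]; last exact: cvg_snd.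
by apply: (@continuous_comp _ _ _ fst a); [exact: cvg_fst|exact: ca].
Qed.

Lemma continuous_homotopy_reparam (X Y : topologicalType) (H : X * I -> Y)
    (k : I -> I) :
  continuous H -> continuous k -> continuous (fun p : X * I => H (p.1, k p.2)).
Proof.
move=> cH ck p.
apply: (@continuous_comp _ _ _ (fun p : X * I => (p.1, k p.2)) H); last exact: cH.
apply: continuous_pair => [q|q]; first exact: cvg_fst.
by apply: (@continuous_comp _ _ _ snd k); [exact: cvg_snd|exact: ck].
Qed.

Lemma homotopic_sym (X Y : topologicalType) (f g : X -> Y) :
  homotopic R f g -> homotopic R g f.
Proof.
move=> [H [cH H0 H1]].
have ch : continuous (fun t : R => 1 - t).
  by move=> t; apply: cvgB; [exact: cvg_cst|exact: cvg_id].
have [|k ck kE] := unit_interval_reparam ch; first by move=> t; lra.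
exists (fun p => H (p.1, k p.2)); split => [|x|x] /=.
- exact: (continuous_homotopy_reparam cH ck).
- by rewrite -H1; congr (H (_, _)); apply: val_inj; rewrite kE/= subr0.
- by rewrite -H0; congr (H (_, _)); apply: val_inj; rewrite kE/= subrr.
Qed.

(** Concatenation: [F] runs at double speed up to time 1/2, then [G] at double speed. *)
Lemma homotopic_trans (X Y : topologicalType) (f g h : X -> Y) :
  homotopic R f g -> homotopic R g h -> homotopic R f h.
Proof.
move=> [F [cF F0 F1]] [G [cG G0 G1]].
have c2 : continuous (fun t : R => 2 * t).
  by move=> t; apply: cvgM; [exact: cvg_cst|exact: cvg_id].
(* The clamps by [min] and [max] keep the two time changes inside [0, 1] for every [t], so that both
   are self-maps of the whole interval; they equal 2t and 2t - 1 on the halves where they are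
   used. *)
have ca : continuous (fun t : R => Num.min 1 (2 * t)).
  by move=> t; apply: continuous_min; [exact: cvg_cst|exact: c2].
have cb : continuous (fun t : R => Num.max 0 (2 * t - 1)).
  move=> t; apply: (@continuous_max R R (fun=> 0) (fun t => 2 * t - 1)); first exact: cvg_cst.
  by apply: cvgB; [exact: c2|exact: cvg_cst].
have [|a cta aE] := unit_interval_reparam ca.
  by move=> t t01; rewrite ge_min le_min lexx/=; lra.
have [|b ctb bE] := unit_interval_reparam cb.
  by move=> t t01; rewrite le_max ge_max lexx/=; lra.
pose A := [set p : X * I | val p.2 <= 2^-1].
pose B := [set p : X * I | 2^-1 <= val p.2].
have cv : continuous (fun p : X * I => val p.2 : R).
  move=> p; apply: (@continuous_comp _ _ _ snd (val : I -> R)).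
    exact: cvg_snd.
  exact: continuous_unit_interval_val.
have clA : closed A.
  apply: (@closed_comp _ _ _ [set x : R | x <= 2^-1]) => [p _|].
    exact: cv.
  exact: closed_le.
have clB : closed B.
  apply: (@closed_comp _ _ _ [set x : R | 2^-1 <= x]) => [p _|].
    exact: cv.
  exact: closed_ge.
pose H p : Y := if val p.2 <= 2^-1 then F (p.1, a p.2) else G (p.1, b p.2).
exists H; split => [|x|x].
(* Pasting lemma: [A] and [B] are closed and cover the cylinder, so continuity of [H] on each of
   them suffices. *)
- apply/continuous_subspace_setT.
  have -> : [set: X * I] = A `|` B.
    by apply/seteqP; split => // p _ /=; apply/orP; exact: le_total.
  apply: withinU_continuous => //.
  + apply: (@subspace_eq_continuous _ A _ (fun p => F (p.1, a p.2))).
      by move=> p; rewrite inE => pA; rewrite /from_subspace /H ifT.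
    exact: (continuous_subspaceT (continuous_homotopy_reparam cF cta)).
  + apply: (@subspace_eq_continuous _ B _ (fun p => G (p.1, b p.2))).
      move=> [x t]; rewrite inE => le_t; rewrite /from_subspace /H.
      (* The two formulas meet only at t = 1/2, where [F] has reached [g] and [G] starts from it. *)
      case: ifPn => // t_le.
      have tE : val t = 2^-1 by apply/le_anti; rewrite t_le.
      have -> : b t = unit_interval0 R.
        by apply: val_inj; rewrite bE tE divff ?pnatr_eq0// subrr maxxx.
      have -> : a t = unit_interval1 R.
        by apply: val_inj; rewrite aE tE divff ?pnatr_eq0// minxx.
      by rewrite F1 G0.
    exact: (continuous_subspaceT (continuous_homotopy_reparam cG ctb)).
- rewrite /H /= invr_ge0 ler0n -F0; congr (F (_, _)).
  by apply: val_inj; rewrite aE/= mulr0 min_r.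
- rewrite /H /= ifF -?G1; last by apply/negbTE; rewrite -ltNge; lra.
  congr (G (_, _)); apply: val_inj; rewrite bE/= mulr1 max_r; lra.
Qed.

Lemma has_homotopic_cover_transfer (X Y X' Y' : topologicalType) (n k : nat)
    (f : 'I_n -> continuousType X Y) (g : 'I_n -> continuousType X' Y')
    (b : X' -> X) (e : Y -> Y') :
  continuous b -> continuous e ->
  (forall i, homotopic R (e \o f i \o b) (g i)) ->
  has_homotopic_cover R f k -> has_homotopic_cover R g k.
Proof.
move=> cb ce efbg [U [oU covU fU]].
pose V j := b @^-1` U j.
exists V; split => [j||j i i' ii'].
- by apply: open_comp; [move=> x _; exact: cb|exact: oU].
- by rewrite -preimage_bigcup covU preimage_setT.
have bV (x : V j) : b (val x) \in U j by rewrite inE; have := valP x; rewrite inE.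
(* The map [b] restricted to [V j] and corestricted to [U j], so that homotopies over [U j] can be
   precomposed with it. *)
pose r (x : V j) : U j := exist _ (b (val x)) (bV x).
have cr : continuous r.
  apply: continuous_comp_initial => x.
  rewrite set_valE.
  apply: (@continuous_comp _ _ _ (set_val : V j -> X') b); last exact: cb.
  exact: continuous_set_val.
(* The left-hand map is, up to conversion, [e \o f m \o b] restricted to [V j]; hence restricting
   [efbg m] along the inclusion is enough. *)
have gV (m : 'I_n) :
    homotopic R (e \o sigL (U j) (f m) \o r) (sigL (V j) (g m)).
  exact: (homotopic_comp (@continuous_set_val _ (V j)) (fun=> cvg_id) (efbg m)).
(* The chain of homotopies is assembled from its right end. *)
apply: homotopic_trans (gV i').
apply: homotopic_trans (homotopic_comp cr ce (fU j i i' ii')).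
exact/homotopic_sym/gV.
Qed.

End Homotopic.

Theorem theorem4p1 (R : realType) (X Y X' Y' : topologicalType) (n : nat)
    (f : 'I_n -> continuousType X Y) (g : 'I_n -> continuousType X' Y')
    (beta : continuousType X' X) (eta : continuousType Y' Y)
    (hbeta : homotopy_equivalence R beta) (heta : homotopy_equivalence R eta)
    (hfg : forall i : 'I_n, homotopic R (f i \o beta) (eta \o g i)) :
  homotopic_distance R f = homotopic_distance R g.
Proof.
have [beta' [_ betaK]] := hbeta; have [eta' [etaK _]] := heta.
(* The distance depends on the family only through this predicate on [k], so its equality settles
   the finite and infinite cases together. *)
suff covE : has_homotopic_cover R f = has_homotopic_cover R g.
  by rewrite /homotopic_distance covE.
apply/funext => k; apply/propext; split.
- apply: (@has_homotopic_cover_transfer _ _ _ _ _ _ _ _ _ beta eta') => [||i].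
  + exact: cts_fun.
  + exact: cts_fun.
  (* eta' f_i beta ~ eta' eta g_i ~ g_i. *)
  + apply: homotopic_trans
      (homotopic_comp (@cts_fun _ _ (g i)) (fun=> cvg_id) etaK).
    exact: (homotopic_comp (fun=> cvg_id) (@cts_fun _ _ eta') (hfg i)).
- apply: (@has_homotopic_cover_transfer _ _ _ _ _ _ _ _ _ beta' eta) => [||i].
  + exact: cts_fun.
  + exact: cts_fun.
  (* eta g_i beta' ~ f_i beta beta' ~ f_i. *)
  + apply: homotopic_trans
      (homotopic_comp (fun=> cvg_id) (@cts_fun _ _ (f i)) betaK).
    have /homotopic_sym hgf := hfg i.
    exact: (homotopic_comp (@cts_fun _ _ beta') (fun=> cvg_id) hgf).
Qed.
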